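(* Let $q_A,q_B,r_A,r_B>0$ and $m_A,m_B\in\mathbb{R}$, and set $c_1=5\,(r_A^{-2}+r_B^{-2})^{1/2}$, $c_2=\sqrt{q_A^2+q_B^2}\,(1+m_A^2+m_B^2)$. Let $T>0$ satisfy $$T\le \mathcal{T}(m_A,m_B):=(c_1c_2)^{-1/2}\arctan\!\big((1+m_A^2+m_B^2)\,(c_2/c_1)^{-1/2}\big).$$ Then the coupled Riccati system $$\dot\theta^A=\theta^AR_A\theta^A+\theta^AR_B\theta^B+\theta^BR_B\theta^A-Q_A,$$ $$\dot\theta^B=\theta^BR_B\theta^B+\theta^AR_A\theta^B+\theta^BR_A\theta^A-Q_B,$$ with terminal conditions $\theta^A(T)=\theta^B(T)=0$, admits a unique solution $(\theta^A,\theta^B)$, with values in pairs of real symmetric $2\times 2$ matrices, over $[0,T]$.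
   Context: The matrices are $$Q_A=\begin{bmatrix} q_A & -m_Aq_A\\ -m_Aq_A & m_A^2q_A\end{bmatrix},\quad R_A=\begin{bmatrix}1/r_A&0\\0&0\end{bmatrix},\quad Q_B=\begin{bmatrix} m_B^2q_B & -m_Bq_B\\ -m_Bq_B & q_B\end{bmatrix},\quad R_B=\begin{bmatrix}0&0\\0&1/r_B\end{bmatrix}.$$ *)

(* Defs.v *)
From HB Require Import structures.
From mathcomp Require Import all_boot all_order all_algebra.
From mathcomp Require Import all_classical all_reals all_analysis.

Set Implicit Arguments.
Unset Strict Implicit.
Unset Printing Implicit Defensive.

Import Order.TTheory GRing.Theory Num.Theory.
Import numFieldNormedType.Exports.

Local Open Scope classical_set_scope.
Local Open Scope ring_scope.

Section Riccati.
Context {R : realType}.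

Definition mx2 (a b c d : R) : 'M[R]_2 :=
  \matrix_(i < 2, j < 2)
    if i == ord0 then (if j == ord0 then a else b)
    else (if j == ord0 then c else d).

Definition QA (qA mA : R) : 'M[R]_2 :=
  mx2 qA (- (mA * qA)) (- (mA * qA)) (mA ^+ 2 * qA).
Definition RA (rA : R) : 'M[R]_2 := mx2 rA^-1 0 0 0.
Definition QB (qB mB : R) : 'M[R]_2 :=
  mx2 (mB ^+ 2 * qB) (- (mB * qB)) (- (mB * qB)) qB.
Definition RB (rB : R) : 'M[R]_2 := mx2 0 0 0 rB^-1.

Definition c1 (rA rB : R) : R := 5 * Num.sqrt (rA ^- 2 + rB ^- 2).

Definition c2 (qA qB mA mB : R) : R :=
  Num.sqrt (qA ^+ 2 + qB ^+ 2) * (1 + mA ^+ 2 + mB ^+ 2).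

Definition horizon_bound (qA qB rA rB mA mB : R) : R :=
  (Num.sqrt (c1 rA rB * c2 qA qB mA mB))^-1 *
  atan ((1 + mA ^+ 2 + mB ^+ 2) *
        (Num.sqrt (c2 qA qB mA mB / c1 rA rB))^-1).

(* The derivative at t of f restricted to [0, T]: at t = 0 and t = T the
   limit is one-sided, and the values of f outside [0, T] play no role. *)
Definition has_derivative_on (T : R) (f : R -> 'M[R]_2) (t : R)
    (v : 'M[R]_2) : Prop :=
  (s - t)^-1 *: (f s - f t) @[s --> within [set` `[0, T]] t^'] --> v.

Definition riccati_solution (qA qB rA rB mA mB T : R)
    (thA thB : R -> 'M[R]_2) : Prop :=
  [/\ forall t : R, t \in `[0, T] -> (thA t)^T = thA t /\ (thB t)^T = thB t,
      forall t : R, t \in `[0, T] ->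
        has_derivative_on T thA t
          (thA t *m RA rA *m thA t + thA t *m RB rB *m thB t
           + thB t *m RB rB *m thA t - QA qA mA),
      forall t : R, t \in `[0, T] ->
        has_derivative_on T thB t
          (thB t *m RB rB *m thB t + thA t *m RA rA *m thB t
           + thB t *m RA rA *m thA t - QB qB mB),
      thA T = 0
    & thB T = 0].

End Riccati.

(* Main.v *)
(* The entries of (thA, thB), as functions of t - T, solve a quadratic system
   x' = p + B(x, x), x(0) = 0, which is solved by a power series.  If the
   entries of p are at most P and the coefficients of each component of B have
   absolute values summing to at most K, the coefficients of the series are
   dominated by (P / w) w^n as soon as 2 w^2 >= P K.  Here P = c2 and
   K = c1 / 2 are admissible, so that w = sqrt(c1 c2) / 2, and since atan is
   less than pi / 2 < 2 the horizon bound gives T w < 1: one series represents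
   the solution on the whole of [0, T].  Uniqueness is Gronwall's argument, and
   it implies symmetry because (thA^T, thB^T) solves the same problem. *)
Require Import Defs.
From HB Require Import structures.
From mathcomp Require Import all_boot all_order all_algebra.
From mathcomp Require Import all_classical all_reals all_analysis.
From mathcomp Require Import zify ring lra.

Set Implicit Arguments.
Unset Strict Implicit.
Unset Printing Implicit Defensive.

Import Order.TTheory GRing.Theory Num.Theory.
Import numFieldNormedType.Exports.

Local Open Scope classical_set_scope.
Local Open Scope ring_scope.

(** * Cauchy products of absolutely convergent series *)

Section CauchyProduct.
Context {R : realType}.
Implicit Types a b : R^nat.

Definition cauchy_product a b : R^nat :=
  fun n => \sum_(k < n.+1) a k * b (n - k)%N.

(** Both sides sum [a i * b j] over the triangle [i + j < n], by diagonals on the left and by rows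
    on the right. *)
Lemma series_cauchy_product a b n :
  series (cauchy_product a b) n = \sum_(i < n) a i * series b (n - i)%N.
Proof.
elim: n => [|n IHn]; first by rewrite /series/= big_geq// big_ord0.
rewrite seriesSr IHn [RHS]big_ord_recr/= subSnn seriesSr.
rewrite [series b 0]big_geq// add0r /cauchy_product big_ord_recr/= subnn addrA.
rewrite -big_split/=; congr (_ + _); apply: eq_bigr => i _.
by rewrite -mulrDr subSn 1?ltnW// seriesSr.
Qed.

(** For nonnegative terms the triangle [i + j < n] contains the square of side [n./2] and lies in
    the square of side [n]. The partial sums are thus squeezed between two products of partial sums,
    both tending to [la * lb]. *)
Lemma series_cauchy_product_ge0_cvg a b (la lb : R) :
  (forall n, 0 <= a n) -> (forall n, 0 <= b n) ->
  series a @ \oo --> la -> series b @ \oo --> lb ->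
  series (cauchy_product a b) @ \oo --> la * lb.
Proof.
move=> a0 b0 cva cvb.
have nds (c : R^nat) : (forall n, 0 <= c n) ->
    {homo series c : m n / (m <= n)%N >-> m <= n}.
  move=> c0; apply/nondecreasing_seqP => n.
  by rewrite seriesSr ler_wpDr.
have s0 (c : R^nat) n : (forall n, 0 <= c n) -> 0 <= series c n.
  by move=> c0; apply: sumr_ge0.
have half_oo : n./2 @[n --> \oo] --> \oo.
  move=> A [N _ NA]; exists N.*2 => //= n Nn; apply: NA => /=.
  by rewrite -(doubleK N) half_leq.
have lo : series a n./2 * series b n./2 @[n --> \oo] --> la * lb.
  apply: cvgM.
  - exact: cvg_comp half_oo cva.
  - exact: cvg_comp half_oo cvb.
apply: (squeeze_cvgr _ lo (cvgM cva cvb)).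
near=> n; rewrite series_cauchy_product/=; apply/andP; split; last first.
    rewrite [series a n]/series /= big_mkord mulr_suml; apply: ler_sum => i _.
    by rewrite ler_wpM2l// nds// leq_subr.
  have hn : (n./2 <= n)%N by lia.
  rewrite [series a n./2]/series /= mulr_suml.
  rewrite -(big_mkord xpredT (fun i => a i * series b (n - i)%N)).
  rewrite (big_cat_nat (n := n./2) (p := n))//=.
  rewrite ler_wpDr ?sumr_ge0// => [i _|]; first by rewrite mulr_ge0// s0.
  rewrite [leLHS]big_nat_cond [leRHS]big_nat_cond.
  apply: ler_sum => i /andP[/andP[_ ih] _]; rewrite ler_wpM2l// nds//.
  by rewrite leq_subRL; lia.
Unshelve. all: by end_near. Qed.

(* With C_n the partial sums of the Cauchy product,
   |A_n B_n - C_n| <= sum_(i < n) |a_i| sum_(n - i <= j < n) |b_j|, and the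
   right-hand side is the same difference for the series of absolute values. *)
Lemma series_cauchy_product_cvg a b :
  cvgn [normed series a] -> cvgn [normed series b] ->
  series (cauchy_product a b) @ \oo --> limn (series a) * limn (series b).
Proof.
move=> na nb.
have cva := normed_cvg na; have cvb := normed_cvg nb.
have cvab : (fun n => series a n * series b n) @ \oo -->
    limn (series a) * limn (series b) by exact: cvgM.
pose na' : R^nat := fun n => `|a n|; pose nb' : R^nat := fun n => `|b n|.
have D0 : (fun n => series na' n * series nb' n
    - series (cauchy_product na' nb') n) @ \oo --> 0.
  rewrite -[X in _ --> X](subrr (limn (series na') * limn (series nb'))).
  apply: cvgB; first exact: cvgM.
  by apply: series_cauchy_product_ge0_cvg => //= n; exact: normr_ge0.
have Z0 : (fun=> 0 : R) @ \oo --> (0 : R) by exact: cvg_cst.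
have N0 : `|series a n * series b n - series (cauchy_product a b) n|
    @[n --> \oo] --> (0 : R).
  apply: (squeeze_cvgr _ Z0 D0).
  near=> n; rewrite normr_ge0/= !series_cauchy_product.
  rewrite [series a n]/series [series na' n]/series /= !big_mkord !mulr_suml.
  rewrite -!sumrB; apply: le_trans (ler_norm_sum _ _ _) _.
  apply: ler_sum => i _; rewrite -!mulrBr normrM ler_wpM2l//.
  by rewrite !sub_series_geq ?leq_subr// ler_norm_sum.
have E0 : (fun n => series a n * series b n - series (cauchy_product a b) n)
    @ \oo --> 0 by exact: norm_cvg0 N0.
have -> : series (cauchy_product a b) = fun n => series a n * series b n -
    (series a n * series b n - series (cauchy_product a b) n).
  by apply/funext => n; rewrite subKr.
by rewrite -[X in _ --> X]subr0; exact: cvgB.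
Unshelve. all: by end_near. Qed.

End CauchyProduct.

(** * Power series with geometrically bounded coefficients *)

Section GeometricPowerSeries.
Context {R : realType}.
Implicit Types c : R^nat.

Lemma pseries_geometric_normed_cvg c (D w x : R) :
  (forall n, `|c n| <= D * w ^+ n) -> `|x| * w < 1 -> 0 <= w ->
  cvgn [normed series (fun n => c n * x ^+ n)].
Proof.
move=> cw xw w0; apply: (@series_le_cvg _ _ (geometric D (w * `|x|))) => [n|n|n|].
- exact: normr_ge0.
- by rewrite /= exprMn mulrA mulr_ge0 ?exprn_ge0//; apply: le_trans (cw n).
- by rewrite /= normrM normrX exprMn mulrA ler_wpM2r// exprn_ge0.
- by apply: is_cvg_geometric_series; rewrite ger0_norm ?mulr_ge0// mulrC.
Qed.

(** Each of the [n.+1] terms of [1 + q + ... + q^n] is at least [q^n], and this sum is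
    [(1 - q^(n+1)) / (1 - q)]. *)
Lemma natr_mul_geometric_le (q : R) n : 0 <= q < 1 ->
  n.+1%:R * q ^+ n <= (1 - q)^-1.
Proof.
move=> /andP[q0 q1]; rewrite -[leRHS]mul1r ler_pdivlMr ?subr_gt0//.
apply: (@le_trans _ _ (1 - q ^+ n.+1)); last first.
  by rewrite gerBl exprn_ge0.
rewrite -[X in _ <= X - _](expr1n _ n.+1) subrXX mulrC.
rewrite ler_wpM2l ?subr_ge0 ?(ltW q1)//.
rewrite mulr_natl -[X in _ *+ X]card_ord -sumr_const. apply: ler_sum => i _.
by rewrite expr1n mul1r ler_wiXn2l ?(ltW q1)// -ltnS.
Qed.

(** The factor [n.+1] produced by differentiation is absorbed by enlarging the ratio, with the
    previous lemma at [q = w / w']. *)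
Lemma pseries_diffs_geometric c (D w w' : R) :
  (forall n, `|c n| <= D * w ^+ n) -> 0 <= w < w' ->
  forall n, `|pseries_diffs c n| <= D * w * (1 - w / w')^-1 * w' ^+ n.
Proof.
move=> cw /andP[w0 ww'] n; have w'0 : 0 < w' by exact: le_lt_trans ww'.
rewrite /pseries_diffs normrM ger0_norm//.
apply: le_trans (_ : n.+1%:R * (D * w ^+ n.+1) <= _); first by rewrite ler_wpM2l.
have D0 : 0 <= D by have := cw 0; rewrite expr0 mulr1; apply: le_trans.
have -> : n.+1%:R * (D * w ^+ n.+1) =
    D * w * (n.+1%:R * (w / w') ^+ n) * w' ^+ n.
  rewrite exprMn exprVn exprS; field.
  by rewrite expf_neq0// gt_eqF.
rewrite ler_wpM2r ?exprn_ge0 ?(ltW w'0)// ler_wpM2l ?mulr_ge0//.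
apply: natr_mul_geometric_le.
by rewrite divr_ge0 ?(ltW w'0)//= ltr_pdivrMr// mul1r.
Qed.

(** [pseries_snd_diffs] asks for a point [K] beyond [|x|] at which the series and its first two
    formal derivatives converge. Each differentiation costs a larger ratio, hence the chain
    [w < w1 < w2 < K^-1]. *)
Lemma is_derive_pseries_geometric c (D w x : R) :
  (forall n, `|c n| <= D * w ^+ n) -> 0 < w -> `|x| * w < 1 ->
  is_derive x 1 (fun y => limn (pseries c y)) (limn (pseries (pseries_diffs c) x)).
Proof.
move=> cw w0 xw.
pose mid (a b : R) := (a + b) / 2.
have midP a b : a < b -> a < mid a b < b by rewrite /mid => ab; lra.
have xw' : `|x| < w^-1 by rewrite -[w^-1]mul1r ltr_pdivlMr.
have /andP[xK Kw] := midP _ _ xw'; set K := mid _ _ in xK Kw.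
have K0 : 0 < K by exact: le_lt_trans xK.
have wK : w < K^-1 by rewrite -[K^-1]mul1r ltr_pdivlMr// mulrC -ltr_pdivlMr// mul1r.
have /andP[ww1 w1K] := midP _ _ wK; set w1 := mid _ _ in ww1 w1K.
have /andP[w12 w2K] := midP _ _ w1K; set w2 := mid _ _ in w12 w2K.
have w10 := lt_trans w0 ww1; have w20 := lt_trans w10 w12.
have Kx1 v : v < K^-1 -> `|K| * v < 1.
  by move=> vK; rewrite gtr0_norm// mulrC -ltr_pdivlMr// mul1r.
have cw1 := pseries_diffs_geometric cw (introT andP (conj (ltW w0) ww1)).
have cw2 := pseries_diffs_geometric cw1 (introT andP (conj (ltW w10) w12)).
apply: (@pseries_snd_diffs _ c K).
- by apply: normed_cvg; apply: pseries_geometric_normed_cvg cw (Kx1 _ wK) (ltW w0).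
- by apply: normed_cvg; apply: pseries_geometric_normed_cvg cw1 (Kx1 _ w1K) (ltW w10).
- by apply: normed_cvg; apply: pseries_geometric_normed_cvg cw2 (Kx1 _ w2K) (ltW w20).
- by rewrite (gtr0_norm K0).
Qed.

End GeometricPowerSeries.

(** Needed because a Cauchy product makes each new coefficient of the series depend on all the
    earlier ones. *)
Lemma strong_recursion (X : Type) (x0 : X) (F : nat -> (nat -> X) -> X) :
  (forall n f g, (forall k, (k <= n)%N -> f k = g k) -> F n f = F n g) ->
  exists b : nat -> X, b 0%N = x0 /\ forall n, b n.+1 = F n b.
Proof.
move=> Fext.
(* [g n] holds the final values up to index [n] and repeats the value at [n] from there on; the
   diagonal of [g] is the sequence sought. *)
pose g := fix g n := if n isn't m.+1 then fun=> x0 else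
  fun k => if (k <= m)%N then g m k else F m (g m).
have gE n k : (k <= n)%N -> g n k = g k k.
  elim: n k => [|n IHn] k; first by rewrite leqn0 => /eqP->.
  rewrite leq_eqVlt => /predU1P[->//|]; rewrite ltnS => kn /=.
  by rewrite kn IHn.
have gS n : g n.+1 n.+1 = F n (g n) by rewrite /= ltnn.
exists (fun n => g n n); split=> // n; rewrite gS; apply: Fext => k kn.
exact: gE.
Qed.

(** * Existence for quadratic systems, by power series *)

Section QuadraticSystem.
Context {R : realType} (I : Type).

(* [p i + sum_m c x_j x_k] over the monomials [m = (c, j, k)] listed by [s i]. *)
Definition quadratic_field (p : I -> R) (s : I -> seq (R * I * I))
    (x : I -> R) (i : I) : R :=
  p i + \sum_(m <- s i) m.1.1 * (x m.1.2 * x m.2).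

(** The coefficient of [t^n] in the quadratic field along the formal series with coefficients [b];
    the constant [p] enters for [n = 0] only. *)
Definition quadratic_coef (p : I -> R) (s : I -> seq (R * I * I))
    (n : nat) (b : nat -> I -> R) (i : I) : R :=
  p i *+ (n == 0)%N +
  \sum_(m <- s i) m.1.1 * cauchy_product (b^~ m.1.2) (b^~ m.2) n.

Lemma quadratic_coef_ext p s n b b' :
  (forall k, (k <= n)%N -> b k = b' k) ->
  quadratic_coef p s n b = quadratic_coef p s n b'.
Proof.
move=> bb'; apply/funext => i; congr (_ + _); apply: eq_bigr => m _.
congr (_ * _); apply: eq_bigr => k _.
by rewrite !bb'// ?leq_subr// -ltnS.
Qed.

(** Counts the splittings of [n] into two odd parts. Only these contribute to the Cauchy products
    bounded below, where even coefficients vanish; this halving of the count gives the factor 2 in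
    [P * K <= 2 * w ^+ 2]. *)
Lemma sum_odd_odd n :
  (\sum_(k < n.+1) (odd k * odd (n - k)) = (~~ odd n) * (n.+1)./2)%N.
Proof.
have -> : (\sum_(k < n.+1) (odd k * odd (n - k)) =
    \sum_(k < n.+1) (~~ odd n) * odd k)%N.
  apply: eq_bigr => k _; rewrite oddB; last by rewrite -ltnS.
  by case: (odd n); case: (odd k).
rewrite -big_distrr/=; congr (_ * _)%N.
rewrite -[uphalf n]/(n.+1)./2; elim: (n.+1) => [|m IHm]; first by rewrite big_ord0.
by rewrite big_ord_recr/= IHm uphalf_half addnC.
Qed.

(* Majorant method: the coefficients are dominated by those of the solution of
   y' = P + K y^2, y(0) = 0, that is of sqrt(P/K) tan(sqrt(P K) t), which are
   at most (P / w) w^n for odd n, and zero for even n, once w >= sqrt(P K / 2).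
*)
Lemma quadratic_coef_bound p s (P K w : R) (b : nat -> I -> R) :
  (forall i, `|p i| <= P) -> (forall i, \sum_(m <- s i) `|m.1.1| <= K) ->
  0 < w -> P * K <= 2 * w ^+ 2 ->
  b 0%N = (fun=> 0) ->
  (forall n, b n.+1 = fun i => quadratic_coef p s n b i / n.+1%:R) ->
  forall n i, `|b n i| <= (odd n)%:R * (P / w) * w ^+ n.
Proof.
move=> pP sK w0 PK b0 bS; set D := P / w.
elim/ltn_ind => -[|n] IHn i; first by rewrite b0 normr0 /= !mul0r.
have P0 : 0 <= P by apply: le_trans (pP i).
have D0 : 0 <= D by rewrite divr_ge0// ltW.
have KD : K * D <= 2 * w by rewrite mulrA ler_pdivrMr// -mulrA -expr2 mulrC.
have cp j k : `|cauchy_product (b^~ j) (b^~ k) n| <=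
    ((~~ odd n) * (n.+1)./2)%:R * (D ^+ 2 * w ^+ n).
  rewrite -sum_odd_odd natr_sum mulr_suml.
  apply: le_trans (ler_norm_sum _ _ _) _; apply: ler_sum => l _.
  have ln : (l <= n)%N by rewrite -ltnS.
  rewrite normrM natrM.
  apply: le_trans (ler_pM _ _ (IHn l _ j) (IHn (n - l)%N _ k)) _ => //.
    by rewrite ltnS leq_subr.
  rewrite -[X in _ <= _ * (_ * w ^+ X)](subnKC ln) exprD.
  by rewrite le_eqVlt; apply/orP; left; apply/eqP; ring.
rewrite bS /= normrM normfV normr_nat ler_pdivrMr ?ltr0n//.
apply: le_trans (ler_normD _ _) _.
apply: (@le_trans _ _ (P *+ (n == 0)%N +
    ((~~ odd n) * (n.+1)./2)%:R * (K * D ^+ 2 * w ^+ n))).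
  apply: lerD; first by case: (n == 0)%N; rewrite ?mulr1n// !mulr0n normr0.
  apply: le_trans (ler_norm_sum _ _ _) _.
  apply: (@le_trans _ _ (\sum_(m <- s i) `|m.1.1| *
     (((~~ odd n) * (n.+1)./2)%:R * (D ^+ 2 * w ^+ n)))).
    by apply: ler_sum => m _; rewrite normrM ler_wpM2l.
  rewrite -mulr_suml -[K * _ * _]mulrA [leRHS]mulrCA.
  rewrite ler_wpM2r//; apply: mulr_ge0 => //; apply: mulr_ge0.
    exact: exprn_ge0.
  by rewrite exprn_ge0 ?ltW.
(* The first coefficient is [p i] alone, since the product term vanishes, and its bound [P / w * w]
   is exactly [P]. Later coefficients come from the product alone. *)
case: n {cp IHn} => [|n].
  rewrite /= mulr1n mul0r addr0 mul1r expr1 mulr1.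
  by rewrite divfK ?gt_eqF.
rewrite /= mulr0n add0r; case: (odd n) => /=; last by rewrite !mul0r.
rewrite mul1n !mul1r.
have -> : n./2.+1%:R * (K * D ^+ 2 * w ^+ n.+1) =
  n./2.+1%:R * (K * D) * (D * w ^+ n.+1) :> R by ring.
have -> : D * w ^+ n.+2 * n.+2%:R = n.+2%:R * w * (D * w ^+ n.+1) :> R.
  by rewrite [w ^+ n.+2]exprS; ring.
rewrite ler_wpM2r//; first by rewrite mulr_ge0// exprn_ge0 ?ltW.
(* What remains is that twice the number [n./2.+1] of splittings is at most [n.+2], the denominator
   in the recurrence. *)
apply: le_trans (ler_wpM2l _ KD) _ => //.
rewrite mulrA ler_wpM2r ?(ltW w0)// -natrM ler_nat; lia.
Qed.

(** The majorant makes the series converge absolutely for [|t| < 1 / w], so that it can be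
    differentiated termwise and multiplied there. *)
Lemma quadratic_system_solution (p : I -> R) (s : I -> seq (R * I * I))
    (P K w : R) :
  (forall i, `|p i| <= P) -> (forall i, \sum_(m <- s i) `|m.1.1| <= K) ->
  0 < w -> P * K <= 2 * w ^+ 2 ->
  exists x : I -> R -> R, (forall i, x i 0 = 0) /\
    forall (i : I) (t : R), `|t| * w < 1 ->
      is_derive t 1 (x i) (quadratic_field p s (x^~ t) i).
Proof.
move=> pP sK w0 PK.
have [b [b0 bS]] := @strong_recursion (I -> R) (fun=> 0)
  (fun n b i => quadratic_coef p s n b i / n.+1%:R)
  (fun n f g fg => funext (fun i =>
     congr1 (fun h => h i / n.+1%:R) (quadratic_coef_ext p s fg))).
have bw n i : `|b n i| <= P / w * w ^+ n.
  have P0 : 0 <= P by apply: le_trans (pP i).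
  apply: le_trans (quadratic_coef_bound pP sK w0 PK b0 bS n i) _.
  case: (odd n); rewrite ?mul1r// !mul0r.
  by rewrite mulr_ge0 ?divr_ge0 ?exprn_ge0 ?(ltW w0).
exists (fun i t => limn (pseries (b^~ i) t)); split=> [i|i t tw].
  apply: (@cvg_lim _ (@Rhausdorff R)); apply: cvg_near_cst; apply: nearW => n.
  rewrite /pseries /series /= big1// => k _.
  by case: k => [|k]; rewrite ?b0 ?mul0r// exprS mul0r mulr0.
have -> : quadratic_field p s (fun j => limn (pseries (b^~ j) t)) i =
    limn (pseries (pseries_diffs (b^~ i)) t).
  apply/esym/(@cvg_lim _ (@Rhausdorff R)).
  have nc j := pseries_geometric_normed_cvg (bw^~ j) tw (ltW w0).
  (* The recurrence for [(n + 1) b_(n+1)] makes the partial sums agree exactly; [t^n] is shared as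
     [t^k t^(n-k)] between the factors of the product. *)
  have -> : pseries (pseries_diffs (b^~ i)) t = fun N =>
      series (fun n => p i *+ (n == 0)%N) N + \sum_(m <- s i) m.1.1 *
      series (cauchy_product (fun n => b n m.1.2 * t ^+ n)
                             (fun n => b n m.2 * t ^+ n)) N.
    apply/funext => N; rewrite /pseries /series /=.
    under [X in _ = _ + X]eq_bigr do rewrite mulr_sumr.
    rewrite exchange_big -big_split; apply: eq_bigr => n _ /=.
    rewrite /pseries_diffs bS [_ * (_ / _)]mulrC divfK ?pnatr_eq0// mulrDl.
    congr (_ + _).
      by case: n => [|n]; rewrite ?expr0 ?mulr1// mulr0n mul0r.
    rewrite mulr_suml; apply: eq_bigr => m _; rewrite -mulrA; congr (_ * _).
    rewrite mulr_suml; apply: eq_bigr => k _.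
    have kn : (k <= n)%N by rewrite -ltnS.
    by rewrite -[X in _ * t ^+ X = _](subnKC kn) exprD; ring.
  apply: cvgD.
    (* The partial sum equals [p i] once [N > 0]; at [N = 0] it is empty. *)
    apply: cvg_near_cst; near=> N.
    have N0 : (0 < N)%N by near: N; exact: nbhs_infty_gt.
    rewrite /series/= -(prednK N0) big_nat_recl// big1 ?addr0// => k _.
  apply: cvg_big => [|m _]; first exact: add_continuous.
  by apply: cvgM; [exact: cvg_cst|exact: series_cauchy_product_cvg].
exact: is_derive_pseries_geometric (bw^~ i) w0 tw.
Unshelve. all: by end_near. Qed.

End QuadraticSystem.

(** * Uniqueness for quadratic systems with a prescribed terminal value *)

Section QuadraticUniqueness.
Context {R : realType} (I : finType).

Lemma is_derive_bigsum (r : seq I) (h : I -> R -> R) (t : R) (dh : I -> R) :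
  (forall i, is_derive t (1 : R) (h i) (dh i)) ->
  is_derive t (1 : R) (fun u => \sum_(i <- r) h i u) (\sum_(i <- r) dh i).
Proof.
move=> hd; elim: r => [|i r IHr].
  rewrite big_nil; have -> : (fun u => \sum_(i <- [::]) h i u) = cst 0.
    by apply/funext => u; rewrite big_nil.
  exact: is_derive_cst.
rewrite big_cons; have -> : (fun u => \sum_(j <- i :: r) h j u) =
    h i + (fun u => \sum_(j <- r) h j u).
  by apply/funext => u; rewrite big_cons.
exact: is_deriveD.
Qed.

Context (p : I -> R) (s : I -> seq (R * I * I)).

(** The constant terms cancel, and [x_j x_k - y_j y_k = (x_j - y_j) x_k + (x_k - y_k) y_j]. A
    product of two differences is at most [V] because [2 u v <= u^2 + v^2]. *)
Lemma quadratic_field_lipschitz (x y : I -> R) (M V : R) (i : I) :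
  (forall j, `|x j| <= M) -> (forall j, `|y j| <= M) ->
  (forall j, (x j - y j) ^+ 2 <= V) ->
  `|(x i - y i) * (quadratic_field p s x i - quadratic_field p s y i)| <=
  2 * M * V * \sum_(m <- s i) `|m.1.1|.
Proof.
move=> xM yM dV.
have dd j k : `|x j - y j| * `|x k - y k| <= V.
  have := dV j; have := dV k; rewrite -!(real_normK (num_real (_ - _))).
  move: `|x j - y j| `|x k - y k| => u v vV uV.
  by have := sqr_ge0 (u - v); rewrite sqrrB => uv; lra.
rewrite /quadratic_field opprD addrACA subrr add0r -sumrB !mulr_sumr.
apply: le_trans (ler_norm_sum _ _ _) _; apply: ler_sum => m _.
rewrite -mulrBr mulrCA normrM mulrC ler_wpM2r//.
have -> : (x i - y i) * (x m.1.2 * x m.2 - y m.1.2 * y m.2) =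
    (x i - y i) * (x m.1.2 - y m.1.2) * x m.2 +
    (x i - y i) * (x m.2 - y m.2) * y m.1.2 by ring.
apply: le_trans (ler_normD _ _) _; rewrite !normrM.
have -> : 2 * M * V = V * M + V * M by ring.
by apply: lerD; apply: ler_pM.
Qed.

(* Gronwall for [sum_i (x i - y i)^2], run backwards from [T]. *)
Lemma quadratic_system_unique (T : R) (x y : I -> R -> R) : 0 < T ->
  (forall i, {within `[0, T], continuous (x i)}) ->
  (forall i, {within `[0, T], continuous (y i)}) ->
  (forall i t, t \in `]0, T[%R ->
    is_derive t (1 : R) (x i) (quadratic_field p s (x^~ t) i)) ->
  (forall i t, t \in `]0, T[%R ->
    is_derive t (1 : R) (y i) (quadratic_field p s (y^~ t) i)) ->
  (forall i, x i T = y i T) ->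
  forall i t, t \in `[0, T]%R -> x i t = y i t.
Proof.
move=> T0 cx cy dx dy xyT.
have csum (h : I -> R -> R) : (forall i, {within `[0, T], continuous (h i)}) ->
    {within `[0, T], continuous (fun t => \sum_i h i t)}.
  by move=> ch t; apply: cvg_big => [|i _]; [exact: add_continuous|exact: ch].
(* By continuity on a compact interval both solutions share a bound [M], as the Lipschitz estimate
   requires. *)
have [c _ cmax] : exists2 c, c \in `[0, T]%R & forall t, t \in `[0, T]%R ->
    \sum_i (`|x i t| + `|y i t|) <= \sum_i (`|x i c| + `|y i c|).
  apply: (@EVT_max R (fun t => \sum_i (`|x i t| + `|y i t|))); first exact: ltW.
  apply: csum => i t; apply: cvgD; apply: cvg_norm; [exact: cx|exact: cy].
move: cmax; set M := \sum_i _ => cmax.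
have xyM i t : t \in `[0, T]%R -> `|x i t| + `|y i t| <= M.
  by move=> /cmax; apply: le_trans; rewrite (bigD1 i)//= lerDl sumr_ge0.
pose V t := \sum_i (x i t - y i t) ^+ 2.
pose V' t := \sum_i 2 * ((x i t - y i t) *
  (quadratic_field p s (x^~ t) i - quadratic_field p s (y^~ t) i)).
have V_ge0 t : 0 <= V t by apply: sumr_ge0 => i _; exact: sqr_ge0.
have dV i t : (x i t - y i t) ^+ 2 <= V t.
  by rewrite /V (bigD1 i)//= lerDl sumr_ge0// => j _; exact: sqr_ge0.
pose L := 4 * M * \sum_i \sum_(m <- s i) `|m.1.1|.
have V'L t : t \in `[0, T]%R -> `|V' t| <= L * V t.
  move=> tT; apply: le_trans (ler_norm_sum _ _ _) _.
  have -> : L * V t = \sum_i 2 * (2 * M * V t * \sum_(m <- s i) `|m.1.1|).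
    by rewrite -!mulr_sumr /L; ring.
  apply: ler_sum => i _; rewrite normrM ger0_norm// ler_wpM2l//.
  apply: quadratic_field_lipschitz => // j.
    by apply: le_trans (xyM j t tT); rewrite lerDl.
  by apply: le_trans (xyM j t tT); rewrite lerDr.
(* Since [|V'| <= L V], the function [expR (L * t) * V t] is nondecreasing. It is nonnegative and
   vanishes at [T], hence it is zero on the whole interval. *)
have dW t : t \in `]0, T[%R ->
    is_derive t (1 : R) (fun u => expR (L * u) * V u)
      (expR (L * t) * (L * V t + V' t)).
  move=> tT.
  have dVt : is_derive t (1 : R) V (V' t).
    apply: is_derive_bigsum => i.
    have dxi := dx i t tT; have dyi := dy i t tT.
    apply: (is_derive_eq (is_deriveX 2 (is_deriveB dxi dyi))).
    by rewrite /GRing.scale/= expr1 -mulrA.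
  have dLt : is_derive t (1 : R) (fun u => L * u) L.
    apply: (is_derive_eq (is_deriveZ L (is_derive_id t (1 : R)))).
    by rewrite /GRing.scale/= mulr1.
  have dE := is_derive1_comp (is_derive_expR (L * t)) dLt.
  apply: (is_derive_eq (is_deriveM dE dVt)).
  by rewrite /GRing.scale/=; ring.
have cV : {within `[0, T], continuous V}.
  apply: csum => i t.
  by apply: cvgM; apply: cvgB; (exact: cx || exact: cy).
have cE : {within `[0, T], continuous (fun u => expR (L * u))}.
  apply: continuous_subspaceT => u; apply: continuous_comp.
    exact: mulrl_continuous.
  exact: continuous_expR.
have W_nd := @ger0_derive1_le_cc R (fun u => expR (L * u) * V u) 0 T
  (fun t tT => @ex_derive _ _ _ _ _ _ _ (dW t tT)) _ _.
move=> i t tT.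
have VT : V T = 0 by rewrite /V big1// => j _; rewrite xyT subrr expr0n.
have : expR (L * t) * V t <= expR (L * T) * V T.
  apply: W_nd => //.
  - move=> u uT; rewrite derive1E (@derive_val _ _ _ _ _ _ _ (dW u uT)).
    rewrite mulr_ge0 ?expR_ge0//.
    have := V'L u (subset_itv_oo_cc uT); rewrite ler_norml => /andP[+ _].
    by rewrite -subr_ge0 opprK addrC.
  - by move=> u; apply: cvgM; [exact: cE|exact: cV].
  - by rewrite in_itv/= lexx ltW.
  - by move: tT; rewrite in_itv => /andP[].
rewrite VT mulr0 pmulr_rle0 ?expR_gt0// => Vt0.
have := le_trans (dV i t) Vt0; rewrite le_eqVlt ltNge sqr_ge0 orbF sqrf_eq0.
by rewrite subr_eq0 => /eqP.
Qed.

End QuadraticUniqueness.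

(** * Derivatives relative to [[0, T]] compared with ordinary derivatives *)

Section RestrictedDerivative.
Context {R : realType}.

Lemma cvg_mxP (T : Type) (F : set_system T) (m n : nat) (f : T -> 'M[R]_(m, n))
    (M : 'M[R]_(m, n)) : Filter F ->
  f @ F --> M <-> forall i j, (f x i j) @[x --> F] --> M i j.
Proof.
move=> FF; split=> [fM i j|fM].
  exact: cvg_comp fM (@coord_continuous _ _ _ i j M).
apply/cvg_mx_entourageP => A eA.
have FA := filter_forall _ (fun ij : 'I_m * 'I_n =>
  (cvg_app_entourageP _ _ _).1 (fM ij.1 ij.2) A eA).
change (F [set x | forall i j, (M i j, f x i j) \in A]).
by apply: (filterS _ (FA FF FF)) => x xA i j; rewrite inE; exact: (xA (i, j)).
Qed.

Lemma has_derivative_onP (T t : R) (f : R -> 'M[R]_2) (v : 'M[R]_2) :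
  has_derivative_on T f t v <-> forall i j,
  (s - t)^-1 * (f s i j - f t i j) @[s --> within [set` `[0, T]] t^'] --> v i j.
Proof.
rewrite /has_derivative_on cvg_mxP.
have E i j : (fun s => ((s - t)^-1 *: (f s - f t)) i j) =
    fun s => (s - t)^-1 * (f s i j - f t i j) by apply/funext => s; rewrite !mxE.
by split=> fv i j; move: (fv i j); rewrite E.
Qed.

(** Multiplying the quotient by [s - t], which tends to 0, shows that [f s - f t] tends to 0 off
    [t]; the point [s = t] is then added by hand. *)
Lemma difference_quotient_continuous (A : set R) (f : R -> R) :
  (forall t, A t -> exists v : R,
    (s - t)^-1 * (f s - f t) @[s --> within A t^'] --> v) ->
  {within A, continuous f}.
Proof.
move=> df; apply/subspace_continuousP => t At; have [v fv] := df t At.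
have st : (s - t) @[s --> within A t^'] --> (0 : R).
  apply: cvg_trans (_ : (s - t) @[s --> nbhs t] --> 0).
    apply: cvg_app; apply: cvg_trans (cvg_within _) _; exact: cvg_within.
  by rewrite -[X in _ --> X](subrr t); apply: cvgB; [exact: cvg_id|exact: cvg_cst].
have fst0 : (s - t) * ((s - t)^-1 * (f s - f t)) @[s --> within A t^'] --> (0 : R).
  by rewrite -[X in _ --> X](mul0r v); exact: cvgM.
apply/cvgrPdist_lt => e e0.
have : \forall s \near within A t^',
    `|(s - t) * ((s - t)^-1 * (f s - f t))| < e.
  exact: (cvgr0Pnorm_lt _).1 fst0 e e0.
rewrite !near_withinE; apply: filterS => s + As.
have [->|st0] := eqVneq s t; first by move=> _; rewrite subrr normr0.
move=> /(_ isT As); rewrite /= mulrA divff ?subr_eq0// mul1r.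
by rewrite distrC.
Qed.

(** The change of variable [s = h + t] between the quotient in [s] of [has_derivative_on] and the
    quotient in the increment [h] behind [is_derive]. *)
Lemma dnbhs_shift (t : R) : t^' = (h + t) @[h --> 0^'].
Proof.
apply/seteqP; split=> P.
- move=> Pt; have : \forall s \near t, s != t -> P s by exact: Pt.
  rewrite (near_shift 0 t) => {}Pt.
  change (\forall h \near 0, h != 0 -> P (h + t)).
  apply: filterS Pt => h /= + h0; rewrite /shift/= subr0; apply.
  by rewrite -subr_eq0 addrK.
- move=> Pt; have {}Pt : \forall h \near 0, h != 0 -> P (h + t) by exact: Pt.
  change (\forall s \near t, s != t -> P s); rewrite (near_shift 0 t).
  apply: filterS Pt => h /=; rewrite /shift/= subr0 => + h0; apply.
  by move: h0; rewrite -subr_eq0 addrK.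
Qed.

Lemma within_dnbhs (A : set R) (t : R) : nbhs t A -> within A t^' = t^'.
Proof.
move=> tA; apply/seteqP; split=> P; last exact: cvg_within.
by rewrite /dnbhs /within /=; apply: filterS2 tA => s As + st; apply.
Qed.

Lemma is_derive_difference_quotient (A : set R) (f : R -> R) (t v : R) :
  nbhs t A -> (s - t)^-1 * (f s - f t) @[s --> within A t^'] --> v <->
  is_derive t (1 : R) f v.
Proof.
move=> tA; rewrite within_dnbhs// dnbhs_shift.
have E : (fun h => h^-1 *: ((f \o shift t) (h *: (1 : R)) - f t)) =
    (fun s => (s - t)^-1 * (f s - f t)) \o (fun h => h + t).
  by apply/funext => h /=; rewrite addrK [_ *: 1]mulr1.
split=> [fv|[df dv]].
  have fv' : h^-1 *: ((f \o shift t) (h *: (1 : R)) - f t) @[h --> 0^'] --> v.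
    by rewrite E.
  split; first by apply/cvg_ex; exists v.
  exact: cvg_lim fv'.
by move: df; rewrite /derivable E => /cvgP; rewrite -dv /derive E.
Qed.

Lemma has_derivative_on_continuous (T : R) (f v : R -> 'M[R]_2) i j :
  (forall t, t \in `[0, T] -> has_derivative_on T f t (v t)) ->
  {within `[0, T], continuous (fun t => f t i j)}.
Proof.
move=> fv; apply: difference_quotient_continuous => t tT.
by exists (v t i j); have /has_derivative_onP := fv t tT; apply.
Qed.

Lemma has_derivative_on_is_derive (T t : R) (f : R -> 'M[R]_2) (v : 'M[R]_2) i j :
  t \in `]0, T[ -> has_derivative_on T f t v ->
  is_derive t (1 : R) (fun t => f t i j) (v i j).
Proof.
move=> tT /has_derivative_onP fv.
apply/(is_derive_difference_quotient (A := `[0, T]%classic)) => //.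
have := near_in_itvoo tT; apply: filterS => s; exact: subset_itv_oo_cc.
Qed.

(** A two-sided limit survives restriction, so this covers the endpoints too: the series solution is
    differentiable in the ordinary sense at 0 and at [T]. *)
Lemma is_derive_has_derivative_on (T t : R) (f : R -> 'M[R]_2) (v : 'M[R]_2) :
  (forall i j, is_derive t (1 : R) (fun t => f t i j) (v i j)) ->
  has_derivative_on T f t v.
Proof.
move=> fv; apply/has_derivative_onP => i j.
have ft : (s - t)^-1 * (f s i j - f t i j) @[s --> t^'] --> v i j.
  rewrite -(within_dnbhs (filterT : nbhs t setT)).
  exact: (is_derive_difference_quotient (fun t => f t i j) _ filterT).2 (fv i j).
apply: cvg_trans ft; apply: cvg_app; exact: cvg_within.
Qed.

End RestrictedDerivative.

(** * The Riccati system as a quadratic system in eight scalar unknowns *)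

Section RiccatiAsQuadraticSystem.
Context {R : realType}.
Context (qA qB rA rB mA mB : R).

(* The component [(b, i, j)] is the entry [(i, j)] of [thA] if [b], of [thB]
   otherwise. *)
Definition riccati_index : finType := (bool * 'I_2 * 'I_2)%type.

Definition riccati_state (thA thB : 'M[R]_2) (c : riccati_index) : R :=
  (if c.1.1 then thA else thB) c.1.2 c.2.

Definition riccati_constant : riccati_index -> R :=
  riccati_state (- QA qA mA) (- QB qB mB).

(** [RA] and [RB] have a single nonzero entry, on the diagonal, so each of the three matrix products
    contributes one monomial to each entry. *)
Definition riccati_monomials (c : riccati_index) :
    seq (R * riccati_index * riccati_index) :=
  let: (b, i, j) := c in
  if b then [:: (rA^-1, (true, i, ord0), (true, ord0, j));
                (rB^-1, (true, i, ord_max), (false, ord_max, j));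
                (rB^-1, (false, i, ord_max), (true, ord_max, j))]
  else [:: (rB^-1, (false, i, ord_max), (false, ord_max, j));
           (rA^-1, (true, i, ord0), (false, ord0, j));
           (rA^-1, (false, i, ord0), (true, ord0, j))].

Definition riccati_fieldA (thA thB : 'M[R]_2) : 'M[R]_2 :=
  thA *m RA rA *m thA + thA *m RB rB *m thB + thB *m RB rB *m thA - QA qA mA.

Definition riccati_fieldB (thA thB : 'M[R]_2) : 'M[R]_2 :=
  thB *m RB rB *m thB + thA *m RA rA *m thB + thB *m RA rA *m thA - QB qB mB.

Lemma sum_ord2 (F : 'I_2 -> R) : \sum_(k < 2) F k = F ord0 + F ord_max.
Proof.
by rewrite big_ord_recl big_ord1; congr (_ + F _); apply/val_inj.
Qed.

Lemma mulmx_RA (M N : 'M[R]_2) i j :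
  (M *m RA rA *m N) i j = rA^-1 * (M i ord0 * N ord0 j).
Proof. by rewrite !mxE sum_ord2 !mxE !sum_ord2 !mxE /=; ring. Qed.

Lemma mulmx_RB (M N : 'M[R]_2) i j :
  (M *m RB rB *m N) i j = rB^-1 * (M i ord_max * N ord_max j).
Proof. by rewrite !mxE sum_ord2 !mxE !sum_ord2 !mxE /=; ring. Qed.

Lemma quadratic_field_riccati (thA thB : 'M[R]_2) :
  quadratic_field riccati_constant riccati_monomials (riccati_state thA thB) =
  riccati_state (riccati_fieldA thA thB) (riccati_fieldB thA thB).
Proof.
have mxD (M N : 'M[R]_2) i j : (M + N) i j = M i j + N i j by rewrite mxE.
apply/funext => -[[[] i] j]; rewrite /quadratic_field/= !big_cons big_nil;
  rewrite /riccati_constant /riccati_state/= /riccati_fieldA /riccati_fieldB;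
  by rewrite !mxD !(mulmx_RA, mulmx_RB); ring.
Qed.

(** Transposition reverses products: with [RA], [RB] and [QA] symmetric, it exchanges the roles of
    the two mixed terms and preserves the form of the others. *)
Lemma riccati_fieldA_tr (thA thB : 'M[R]_2) :
  (riccati_fieldA thA thB)^T = riccati_fieldA thA^T thB^T.
Proof.
have mxD (M N : 'M[R]_2) i j : (M + N) i j = M i j + N i j by rewrite mxE.
have trE (M : 'M[R]_2) i j : M^T i j = M j i by rewrite mxE.
have QT : (- QA qA mA)^T = - QA qA mA.
  by apply/matrixP => i j; rewrite !mxE; case: (i == _); case: (j == _).
apply/matrixP => i j; rewrite /riccati_fieldA -[in RHS]QT.
by rewrite trE !mxD !(mulmx_RA, mulmx_RB) !trE; ring.
Qed.

Lemma riccati_fieldB_tr (thA thB : 'M[R]_2) :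
  (riccati_fieldB thA thB)^T = riccati_fieldB thA^T thB^T.
Proof.
have mxD (M N : 'M[R]_2) i j : (M + N) i j = M i j + N i j by rewrite mxE.
have trE (M : 'M[R]_2) i j : M^T i j = M j i by rewrite mxE.
have QT : (- QB qB mB)^T = - QB qB mB.
  by apply/matrixP => i j; rewrite !mxE; case: (i == _); case: (j == _).
apply/matrixP => i j; rewrite /riccati_fieldB -[in RHS]QT.
by rewrite trE !mxD !(mulmx_RA, mulmx_RB) !trE; ring.
Qed.

Lemma has_derivative_on_tr (T t : R) (f : R -> 'M[R]_2) (v : 'M[R]_2) :
  has_derivative_on T f t v -> has_derivative_on T (fun u => (f u)^T) t v^T.
Proof.
move=> /has_derivative_onP fv; apply/has_derivative_onP => i j.
have -> : (fun s => (s - t)^-1 * ((f s)^T i j - (f t)^T i j)) =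
    fun s => (s - t)^-1 * (f s j i - f t j i) by apply/funext => s; rewrite !mxE.
by rewrite mxE; exact: fv.
Qed.

(** Stated for arbitrary matrix-valued functions, so as to apply both to a competing solution and to
    the transpose of the constructed one. *)
Lemma riccati_unique (T : R) (thA thB thA' thB' : R -> 'M[R]_2) : 0 < T ->
  (forall t, t \in `[0, T] ->
    has_derivative_on T thA t (riccati_fieldA (thA t) (thB t))) ->
  (forall t, t \in `[0, T] ->
    has_derivative_on T thB t (riccati_fieldB (thA t) (thB t))) ->
  (forall t, t \in `[0, T] ->
    has_derivative_on T thA' t (riccati_fieldA (thA' t) (thB' t))) ->
  (forall t, t \in `[0, T] ->
    has_derivative_on T thB' t (riccati_fieldB (thA' t) (thB' t))) ->
  thA T = thA' T -> thB T = thB' T ->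
  forall t, t \in `[0, T] -> thA t = thA' t /\ thB t = thB' t.
Proof.
move=> T0 dA dB dA' dB' AT BT.
pose x c t := riccati_state (thA t) (thB t) c.
pose x' c t := riccati_state (thA' t) (thB' t) c.
have cont a b : (forall t, t \in `[0, T] ->
    has_derivative_on T a t (riccati_fieldA (a t) (b t))) ->
  (forall t, t \in `[0, T] ->
    has_derivative_on T b t (riccati_fieldB (a t) (b t))) ->
  forall c, {within `[0, T], continuous (fun t => riccati_state (a t) (b t) c)}.
  move=> da db [[[] i] j].
  - exact: has_derivative_on_continuous da.
  - exact: has_derivative_on_continuous db.
have drv a b : (forall t, t \in `[0, T] ->
    has_derivative_on T a t (riccati_fieldA (a t) (b t))) ->
  (forall t, t \in `[0, T] ->
    has_derivative_on T b t (riccati_fieldB (a t) (b t))) ->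
  forall c t, t \in `]0, T[ ->
    is_derive t (1 : R) (fun t => riccati_state (a t) (b t) c)
      (quadratic_field riccati_constant riccati_monomials
        (riccati_state (a t) (b t)) c).
  move=> da db [[[] i] j] t tT; rewrite quadratic_field_riccati.
  - apply: (has_derivative_on_is_derive _ _ tT (da t _)); exact: subset_itv_oo_cc.
  - apply: (has_derivative_on_is_derive _ _ tT (db t _)); exact: subset_itv_oo_cc.
have xx' := quadratic_system_unique T0 (cont _ _ dA dB) (cont _ _ dA' dB')
  (drv _ _ dA dB) (drv _ _ dA' dB') _.
have {}xx' c t : t \in `[0, T] -> x c t = x' c t.
  by apply: xx' => {}c; rewrite AT BT.
move=> t tT; split; apply/matrixP => i j.
- exact: (xx' (true, i, j) t tT).
- exact: (xx' (false, i, j) t tT).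
Qed.

(** * Bounds on the Riccati data in terms of [c1] and [c2] *)

Context (qA_gt0 : 0 < qA) (qB_gt0 : 0 < qB) (rA_gt0 : 0 < rA) (rB_gt0 : 0 < rB).

(** After squaring, [4 u v <= 2 u^2 + 2 v^2] leaves [3 u^2 + 6 v^2], which is below
    [25/4 (u^2 + v^2)]. The left-hand side is the coefficient sum of one component: one weight
    occurs once, the other twice. *)
Lemma le_c1 (u v : R) : 0 <= u -> 0 <= v ->
  u + 2 * v <= 5 / 2 * Num.sqrt (u ^+ 2 + v ^+ 2).
Proof.
move=> u0 v0; set S := Num.sqrt _.
have S0 : 0 <= S by exact: sqrtr_ge0.
have SE : S ^+ 2 = u ^+ 2 + v ^+ 2 by rewrite sqr_sqrtr// addr_ge0// sqr_ge0.
rewrite -(@ler_pXn2r _ 2)// ?nnegrE; [|lra|lra].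
by rewrite exprMn SE; have := sqr_ge0 (u - v); have := sqr_ge0 u; nra.
Qed.

Lemma riccati_monomials_bound c :
  \sum_(m <- riccati_monomials c) `|m.1.1| <= c1 rA rB / 2.
Proof.
have u0 : 0 <= rA^-1 by rewrite invr_ge0 ltW.
have v0 : 0 <= rB^-1 by rewrite invr_ge0 ltW.
have := le_c1 u0 v0; have := le_c1 v0 u0.
rewrite [rB^-1 ^+ 2 + _]addrC !exprVn /c1; move: (Num.sqrt _) => S h1 h2.
by case: c => -[[] i] j; rewrite /= !big_cons big_nil/= !ger0_norm//; lra.
Qed.

Lemma riccati_constant_bound c : `|riccati_constant c| <= c2 qA qB mA mB.
Proof.
have SA : qA <= Num.sqrt (qA ^+ 2 + qB ^+ 2).
  rewrite -{1}[qA]gtr0_norm// -sqrtr_sqr ler_wsqrtr// lerDl sqr_ge0//.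
have SB : qB <= Num.sqrt (qA ^+ 2 + qB ^+ 2).
  rewrite -{1}[qB]gtr0_norm// -sqrtr_sqr ler_wsqrtr// lerDr sqr_ge0//.
(* Up to sign the entries of either constant matrix are [q], [m q] and [m^2 q], and [1], [|m|],
   [m^2] are all at most [1 + m^2]. *)
have q_le q m m' : 0 < q -> q <= Num.sqrt (qA ^+ 2 + qB ^+ 2) ->
  [/\ `|q| <= Num.sqrt (qA ^+ 2 + qB ^+ 2) * (1 + m ^+ 2 + m' ^+ 2),
      `|- (m * q)| <= Num.sqrt (qA ^+ 2 + qB ^+ 2) * (1 + m ^+ 2 + m' ^+ 2) &
      `|m ^+ 2 * q| <= Num.sqrt (qA ^+ 2 + qB ^+ 2) * (1 + m ^+ 2 + m' ^+ 2)].
  move=> q0 qS; have m0 := sqr_ge0 m; have m'0 := sqr_ge0 m'.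
  have mn : `|m| <= 1 + m ^+ 2.
    by rewrite -real_normK ?num_real//; have := sqr_ge0 (`|m| - 1); nra.
  split.
  - rewrite (gtr0_norm q0) -[leLHS]mulr1; apply: ler_pM => //; [exact: ltW|lra].
  - rewrite normrN normrM (gtr0_norm q0) mulrC; apply: ler_pM => //; [exact: ltW|lra].
  - rewrite normrM (gtr0_norm q0) (ger0_norm m0) mulrC.
    by apply: ler_pM => //; [exact: ltW|lra].
have [a1 a2 a3] := q_le _ mA mB qA_gt0 SA.
have [b1 b2 b3] := q_le _ mB mA qB_gt0 SB.
rewrite addrAC in b1 b2 b3.
case: c => -[[] i] j; rewrite /riccati_constant /riccati_state/= /c2 !mxE normrN.
- by case: (i == _); case: (j == _).
- by case: (i == _); case: (j == _).
Qed.

Lemma c1_gt0 : 0 < c1 rA rB.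
Proof.
by rewrite mulr_gt0// sqrtr_gt0 addr_gt0// invr_gt0 exprn_gt0.
Qed.

Lemma c2_gt0 : 0 < c2 qA qB mA mB.
Proof.
have mA0 := sqr_ge0 mA; have mB0 := sqr_ge0 mB.
rewrite mulr_gt0//; first by rewrite sqrtr_gt0 addr_gt0// exprn_gt0.
lra.
Qed.

Lemma horizon_bound_lt :
  horizon_bound qA qB rA rB mA mB *
    (Num.sqrt (c1 rA rB * c2 qA qB mA mB) / 2) < 1.
Proof.
have w0 : 0 < Num.sqrt (c1 rA rB * c2 qA qB mA mB).
  by rewrite sqrtr_gt0 mulr_gt0// ?c1_gt0 ?c2_gt0.
rewrite /horizon_bound; set a := atan _; move: w0; set w := Num.sqrt _ => w0.
have -> : w^-1 * a * (w / 2) = a / 2 by field; rewrite gt_eqF.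
rewrite ltr_pdivrMr// mul1r.
exact: lt_trans (atan_ltpi2 _) (pihalf_lt2 R).
Qed.

End RiccatiAsQuadraticSystem.

Theorem proposition2 (R : realType) (qA qB rA rB mA mB T : R)
    (qA_gt0 : 0 < qA) (qB_gt0 : 0 < qB) (rA_gt0 : 0 < rA) (rB_gt0 : 0 < rB)
    (T_gt0 : 0 < T) (T_le : T <= horizon_bound qA qB rA rB mA mB) :
  exists thA thB : R -> 'M[R]_2,
    riccati_solution qA qB rA rB mA mB T thA thB /\
    (forall thA' thB' : R -> 'M[R]_2,
       riccati_solution qA qB rA rB mA mB T thA' thB' ->
       forall t : R, t \in `[0, T] -> thA' t = thA t /\ thB' t = thB t).

Proof.
have c1_0 := c1_gt0 rA_gt0 rB_gt0; have c2_0 := c2_gt0 mA mB qA_gt0 qB_gt0.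
set w := Num.sqrt (c1 rA rB * c2 qA qB mA mB) / 2.
have w0 : 0 < w by rewrite divr_gt0// sqrtr_gt0 mulr_gt0.
(* In fact an equality: [w] is the smallest ratio that the majorant method admits for these
   bounds. *)
have wE : c2 qA qB mA mB * (c1 rA rB / 2) <= 2 * w ^+ 2.
  rewrite exprMn sqr_sqrtr; last by apply: mulr_ge0; exact: ltW.
  by rewrite le_eqVlt; apply/orP; left; apply/eqP; field.
have Tw : T * w < 1.
  apply: le_lt_trans (horizon_bound_lt mA mB qA_gt0 qB_gt0 rA_gt0 rB_gt0).
  by rewrite ler_wpM2r// ltW.
have [x [x0 dx]] := quadratic_system_solution
  (riccati_constant_bound mA mB qA_gt0 qB_gt0)
  (riccati_monomials_bound rA_gt0 rB_gt0) w0 wE.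
(* The shift turns the zero value at 0 into the terminal condition at [T]; for [t] in [[0, T]] one
   has [|t - T| <= T], so [T * w < 1] ensures convergence. *)
pose thA t := \matrix_(i < 2, j < 2) x (true, i, j) (t - T).
pose thB t := \matrix_(i < 2, j < 2) x (false, i, j) (t - T).
have xth t : x^~ (t - T) = riccati_state (thA t) (thB t).
  by apply/funext => -[[[] i] j]; rewrite /riccati_state/= mxE.
have dth t (c : riccati_index) : t \in `[0, T] ->
    is_derive t (1 : R) (fun u => x c (u - T))
      (riccati_state (riccati_fieldA qA rA rB mA (thA t) (thB t))
                     (riccati_fieldB qB rA rB mB (thA t) (thB t)) c).
  rewrite in_itv/= => /andP[t0 tT].
  have tw : `|t - T| * w < 1.
    apply: le_lt_trans Tw; rewrite ler_wpM2r ?(ltW w0)//.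
    by rewrite distrC ger0_norm ?subr_ge0// gerBl.
  have dsh : is_derive t (1 : R) (fun u => u - T) 1.
    apply: (is_derive_eq (is_deriveB (is_derive_id t (1 : R)) (is_derive_cst T t 1))).
    by rewrite subr0.
  have dc := @is_derive1_comp R (x c) (fun u => u - T) t _ _ (dx c _ tw) dsh.
  apply: (is_derive_eq dc).
  by rewrite mulr1 xth quadratic_field_riccati.
have dA t : t \in `[0, T] ->
    has_derivative_on T thA t (riccati_fieldA qA rA rB mA (thA t) (thB t)).
  move=> tT; apply: is_derive_has_derivative_on => i j.
  have -> : (fun u => thA u i j) = (fun u => x (true, i, j) (u - T)).
    by apply/funext => u; rewrite mxE.
  exact: dth.
have dB t : t \in `[0, T] ->
    has_derivative_on T thB t (riccati_fieldB qB rA rB mB (thA t) (thB t)).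
  move=> tT; apply: is_derive_has_derivative_on => i j.
  have -> : (fun u => thB u i j) = (fun u => x (false, i, j) (u - T)).
    by apply/funext => u; rewrite mxE.
  exact: dth.
have AT : thA T = 0 by apply/matrixP => i j; rewrite !mxE subrr x0.
have BT : thB T = 0 by apply/matrixP => i j; rewrite !mxE subrr x0.
exists thA, thB; split=> [|thA' thB' [_ dA' dB' A'T B'T] t tT].
  (* Symmetry: the transposed pair solves the same equations with the same zero terminal value. *)
  split=> // t tT; apply: (@riccati_unique _ qA qB rA rB mA mB T
    (fun u => (thA u)^T) (fun u => (thB u)^T) thA thB T_gt0) => // [u uT|u uT||].
  - by rewrite -riccati_fieldA_tr; apply: has_derivative_on_tr; exact: dA.
  - by rewrite -riccati_fieldB_tr; apply: has_derivative_on_tr; exact: dB.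
  - by rewrite AT trmx0.
  - by rewrite BT trmx0.
apply: (@riccati_unique _ qA qB rA rB mA mB T thA' thB' thA thB T_gt0) => //.
- by rewrite A'T AT.
- by rewrite B'T BT.
Qed.
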